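(* Let $S$ be a commutative unital ring, $\sigma\in\mathrm{Aut}(S)$ of finite order $m$, $S_0=\{s\in S:\sigma(s)=s\}$, $n\ge 2$ an integer, and $a,b\in S^\times$. Suppose that $m\nmid n$, or that at least one of $a$, $b$ is not in $S_0$. Let $G:\mathbb{S}_{t^n-a}\to\mathbb{S}_{t^n-b}$ be a Hamming-weight preserving ring homomorphism whose restriction to $S$ is an automorphism $\tau\in\mathrm{Aut}(S)$ commuting with $\sigma$. Then $G$ is monomial of degree one, i.e. $G(t)=\alpha t$ for some $\alpha\in S$ that is not a zero divisor (so $G=G_{\tau,\alpha}$).
   Context: Rings $S$ are commutative, associative, with $1\ne 0$. $S[t;\sigma]$ is the skew polynomial ring with $tc=\sigma(c)t$ for $c\in S$. For a monic $f\in S[t;\sigma]$ of degree $n$, every $g\in S[t;\sigma]$ can be written uniquely as $g=qf+r$ with $\deg r<n$; write $r=g \bmod_r f$. The Petit ring $\mathbb{S}_f$ is the additive group of skew polynomials of degree $<n$ with multiplication $g\circ h=gh \bmod_r f$; it is a unital, in general nonassociative, ring containing $S$ as the constants. The Hamming weight of $\sum_{i=0}^{n-1}c_it^i\in\mathbb{S}_f$ is the number of nonzero $c_i$; a map $G$ is Hamming-weight preserving if $G(p)$ has the same Hamming weight as $p$ for every $p$. $G_{\tau,\alpha}$ denotes the homomorphism with $G|_S=\tau$ and $G(t)=\alpha t$, i.e. $G_{\tau,\alpha}(\sum a_it^i)=\sum\tau(a_i)\left(\prod_{j=0}^{i-1}\sigma^j(\alpha)\right)t^i$. *)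

(* Defs.v *)
From HB Require Import structures.
From mathcomp Require Import all_boot all_order all_algebra.

Set Implicit Arguments.
Unset Strict Implicit.
Unset Printing Implicit Defensive.

Import GRing.Theory.
Local Open Scope ring_scope.

(* S[t;sigma]: \sum_i c_i t^i, coefficients on the left, is represented by    *)
(* the element of {poly S} with the same coefficients.                        *)
Definition skewpoly (S : comUnitRingType) (sigma : {rmorphism S -> S}) : Type :=
  {poly S}.

HB.instance Definition _ (S : comUnitRingType) (sigma : {rmorphism S -> S}) :=
  GRing.Zmodule.copy (skewpoly sigma) {poly S}.

Section Endomorphism.

Variables (S : comUnitRingType) (sigma : {rmorphism S -> S}).

Definition has_order (m : nat) : Prop :=
  [/\ (0 < m)%N, iter m sigma =1 id
    & forall k, (0 < k < m)%N -> ~ (iter k sigma =1 id)].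

Definition fixed_ring : {pred S} := [pred s | sigma s == s].

Fact iter_rmorph_is_zmod k : zmod_morphism (iter k sigma).
Proof. by elim: k => [|k IHk] x y //=; rewrite IHk rmorphB. Qed.

Fact iter_rmorph_is_monoid k : monoid_morphism (iter k sigma).
Proof.
elim: k => [|k [IH1 IHM]] //; split=> [|x y] /=; first by rewrite IH1 rmorph1.
by rewrite IHM rmorphM.
Qed.

HB.instance Definition _ k :=
  GRing.isZmodMorphism.Build S S (iter k sigma) (iter_rmorph_is_zmod k).
HB.instance Definition _ k :=
  GRing.isMonoidMorphism.Build S S (iter k sigma) (iter_rmorph_is_monoid k).

Implicit Types p q r : {poly S}.

Definition skew_mul p q : {poly S} :=
  \poly_(k < (size p + size q).-1)
    (\sum_(i < k.+1) p`_i * iter i sigma q`_(k - i)).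

Lemma coef_skew_mul p q k :
  (skew_mul p q)`_k = \sum_(i < k.+1) p`_i * iter i sigma q`_(k - i).
Proof.
rewrite coef_poly ltn_predRL; case: leqP => // le_pq_k1.
rewrite big1 // => i _; have [lq_p_i|lt_i_p] := leqP (size p) i.
  by rewrite nth_default ?mul0r.
rewrite [q`__]nth_default ?rmorph0 ?mulr0 // leq_subRL -ltnS //.
by rewrite (leq_trans _ le_pq_k1) // ltn_add2r.
Qed.

Lemma coef_skew_mul_rev p q k :
  (skew_mul p q)`_k = \sum_(i < k.+1) p`_(k - i) * iter (k - i) sigma q`_i.
Proof.
rewrite coef_skew_mul (reindex_inj rev_ord_inj) /=.
by apply: eq_bigr => i _; rewrite !subSS (sub_ordK i).
Qed.

Fact skew_mulA : associative skew_mul.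
Proof.
move=> p q r; apply/polyP=> i; rewrite coef_skew_mul coef_skew_mul_rev.
pose coef3 j k := p`_j * (iter j sigma q`_(i - j - k)
                          * iter (i - k) sigma r`_k).
transitivity (\sum_(j < i.+1) \sum_(k < i.+1 | (k <= i - j)%N) coef3 j k).
  apply: eq_bigr => /= j _; rewrite coef_skew_mul_rev rmorph_sum big_distrr /=.
  rewrite (big_ord_narrow_leq (leq_subr _ _)); apply: eq_bigr => k _ /=.
  have le_jk_i: (j + k <= i)%N by rewrite -leq_subRL -ltnS.
  rewrite /coef3 rmorphM /= -iterD -[(i - _ - k)%N]subnAC subnKC //.
  by rewrite leq_subRL ?(leq_trans (leq_addl j k)) // addnC.
rewrite (exchange_big_dep predT) //=; apply: eq_bigr => k _.
transitivity (\sum_(j < i.+1 | (j <= i - k)%N) coef3 j k).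
  apply: eq_bigl => j; rewrite -ltnS -(ltnS j) -!subSn ?leq_ord //.
  by rewrite -subn_gt0 -(subn_gt0 j) -!subnDA addnC.
rewrite (big_ord_narrow_leq (leq_subr _ _)) coef_skew_mul big_distrl /=.
by apply: eq_bigr => j _; rewrite /coef3 -!subnDA addnC mulrA.
Qed.

Fact skew_mul1l : left_id 1 skew_mul.
Proof.
move=> p; apply/polyP=> k; rewrite coef_skew_mul big_ord_recl subn0 coef1 mul1r.
by rewrite big1 ?addr0 // => i _; rewrite coef1 mul0r.
Qed.

Fact skew_mul1r : right_id 1 skew_mul.
Proof.
move=> p; apply/polyP=> k; rewrite coef_skew_mul_rev big_ord_recl subn0 coef1.
by rewrite rmorph1 mulr1 big1 ?addr0 // => i _; rewrite coef1 rmorph0 mulr0.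
Qed.

Fact skew_mulDl : left_distributive skew_mul +%R.
Proof.
move=> p q r; apply/polyP=> k; rewrite coefD !coef_skew_mul -big_split.
by apply: eq_bigr => i _; rewrite coefD mulrDl.
Qed.

Fact skew_mulDr : right_distributive skew_mul +%R.
Proof.
move=> p q r; apply/polyP=> k; rewrite coefD !coef_skew_mul -big_split.
by apply: eq_bigr => i _; rewrite coefD rmorphD mulrDr.
Qed.

HB.instance Definition _ := GRing.Zmodule_isNzRing.Build (skewpoly sigma)
  skew_mulA skew_mul1l skew_mul1r skew_mulDl skew_mulDr (oner_neq0 {poly S}).

Definition skewC (c : S) : skewpoly sigma := c%:P.
Definition skewX : skewpoly sigma := 'X.

Lemma coef_skewM (p q : skewpoly sigma) k :
  (p * q : {poly S})`_k =
  \sum_(i < k.+1) (p : {poly S})`_i * iter i sigma (q : {poly S})`_(k - i).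
Proof. exact: coef_skew_mul. Qed.

Lemma skewXC c : skewX * skewC c = skewC (sigma c) * skewX.
Proof.
rewrite /skewX /skewC; apply/polyP=> k; rewrite !coef_skewM.
case: k => [|k]; first by rewrite !big_ord1 !coefX mul0r rmorph0 mulr0.
rewrite [LHS]big_ord_recl big_ord_recl [RHS]big_ord_recl !big1 => [|i _|i _].
- rewrite !coefX !coefC eqSS /= mul0r add0r !addr0 subSS subn0 mul1r.
  by case: k => [|k]; rewrite ?mulr1 ?rmorph0 ?mulr0.
- by rewrite coefC mul0r.
- by rewrite coefX mul0r.
Qed.

Lemma skewCXn c n : skewC c * skewX ^+ n = (c *: 'X^n : {poly S}).
Proof.
suff Xn: skewX ^+ n = ('X^n : {poly S}).
  rewrite Xn; apply/polyP=> k; rewrite coef_skewM big_ord_recl coefC subn0.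
  by rewrite big1 ?addr0 ?coefZ // => i _; rewrite coefC mul0r.
elim: n => [//|n IHn]; rewrite exprS IHn; apply/polyP=> -[|k].
  by rewrite coef_skewM big_ord1 /skewX coefX mul0r coefXn.
rewrite coef_skewM !big_ord_recl big1 => [|i _]; last by rewrite coefX mul0r.
by rewrite !coefX mul0r add0r mul1r addr0 subSS subn0 !coefXn eqSS /= rmorph_nat.
Qed.

(* t^n - c *)
Definition skewXn_sub (n : nat) (c : S) : skewpoly sigma := skewX ^+ n - skewC c.

Lemma skewXn_subE n c : skewXn_sub n c = ('X^n - c%:P : {poly S}).
Proof. by rewrite /skewXn_sub -[skewX ^+ n]mul1r skewCXn scale1r. Qed.

Lemma size_skewXn_sub n c :
  (0 < n)%N -> size (skewXn_sub n c : {poly S}) = n.+1.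
Proof. by move=> n_gt0; rewrite skewXn_subE size_XnsubC. Qed.

Lemma skewXn_sub_monic n c :
  (0 < n)%N -> (skewXn_sub n c : {poly S}) \is monic.
Proof. by move=> n_gt0; rewrite skewXn_subE monicXnsubC. Qed.

Fixpoint skew_rmod_rec (fuel : nat) (f g : skewpoly sigma) : skewpoly sigma :=
  let: (f', g') := (f : {poly S}, g : {poly S}) in
  if (size g' < size f')%N then g else
  if fuel is k.+1 then
    skew_rmod_rec k f
      (g - skewC (lead_coef g') * skewX ^+ (size g' - size f') * f)
  else g.

(* g mod_r f for monic f: the remainder r of g = q f + r (skew_rmodP). *)
Definition skew_rmod (f g : skewpoly sigma) : skewpoly sigma :=
  skew_rmod_rec (size (g : {poly S})) f g.

Lemma coef_skewCXnM c n (p : skewpoly sigma) k :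
  (skewC c * skewX ^+ n * p : {poly S})`_k =
  if (k < n)%N then 0 else c * iter n sigma (p : {poly S})`_(k - n).
Proof.
rewrite skewCXn coef_skewM; case: ltnP => [lt_kn | le_nk].
  rewrite big1 // => i _; rewrite coefZ coefXn.
  by rewrite ltn_eqF ?mulr0 ?mul0r // (leq_ltn_trans (leq_ord i)).
have lt_nk1: (n < k.+1)%N by [].
rewrite (bigD1 (Ordinal lt_nk1)) //= coefZ coefXn eqxx mulr1 big1 ?addr0 //.
by move=> i; rewrite -val_eqE /= coefZ coefXn => /negPf->; rewrite mulr0 mul0r.
Qed.

Lemma skew_rmodP (f g : skewpoly sigma) : (f : {poly S}) \is monic ->
  (size (skew_rmod f g : {poly S}) < size (f : {poly S}))%N
  /\ exists q : skewpoly sigma, g = q * f + skew_rmod f g.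
Proof.
move=> f_mon; have fn0 := monic_neq0 f_mon.
suff: forall k (h : skewpoly sigma), (size (h : {poly S}) <= k)%N ->
    (size (skew_rmod_rec k f h : {poly S}) < size (f : {poly S}))%N
    /\ exists q : skewpoly sigma, h = q * f + skew_rmod_rec k f h by apply.
move=> k; elim: k {g} => [|k IHk] g le_gk /=; case: ifPn => [lt_gf | nlt_gf].
- by split=> //; exists 0; rewrite mul0r add0r.
- case/negP: nlt_gf; rewrite -ltnS in le_gk.
  by rewrite (leq_trans le_gk) // size_poly_gt0.
- by split=> //; exists 0; rewrite mul0r add0r.
rewrite -leqNgt in nlt_gf; rename nlt_gf into le_fg.
set h := _ * _ ^+ _; have [|lt_r [q Dq]] := IHk (g - h * f).
  apply/leq_sizeP=> j le_kj; rewrite (coefB (g : {poly S}) (h * f : {poly S})).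
  have sf_gt0: (0 < size (f : {poly S}))%N by rewrite size_poly_gt0.
  have [Dj | lt_gj] : j.+1 = size (g : {poly S}) \/
                      (size (g : {poly S}) <= j)%N.
  + by have:= leq_trans le_gk (le_kj : (k.+1 <= j.+1)%N);
       rewrite leq_eqVlt => /orP[/eqP-> | ]; [left | right].
  + rewrite coef_skewCXnM -Dj ltnNge leq_subLR -add1n leq_add2r sf_gt0 /=.
    have ->: (j - (j.+1 - size (f : {poly S})))%N = (size (f : {poly S})).-1.
      by rewrite -Dj in le_fg; case: size sf_gt0 le_fg => // s _;
         rewrite ltnS subSS => /subKn.
    rewrite -[_`_(size _).-1]/(lead_coef (f : {poly S})) (monicP f_mon) rmorph1.
    by rewrite mulr1 lead_coefE -Dj subrr.
  rewrite coef_skewCXnM nth_default // sub0r.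
  case: ifP => _; rewrite ?oppr0 // [_`__]nth_default ?rmorph0 ?mulr0 ?oppr0 //.
  by rewrite leq_subRL ?subnK // (leq_trans (leq_subr _ _)).
split=> //; exists (h + q); rewrite mulrDl -addrA -Dq addrC subrK //.
Qed.

Lemma skew_rmod_uniq (f q q' r r' : skewpoly sigma) : (f : {poly S}) \is monic ->
    (size (r : {poly S}) < size (f : {poly S}))%N ->
    (size (r' : {poly S}) < size (f : {poly S}))%N ->
  q * f + r = q' * f + r' -> q = q' /\ r = r'.
Proof.
move=> f_mon lt_r lt_r' eq_qr.
have sf_gt0: (0 < size (f : {poly S}))%N by rewrite (leq_ltn_trans _ lt_r).
have Dqf: (q - q') * f = r' - r.
  by apply/eqP; rewrite mulrBl subr_eq addrAC [r' + _]addrC -eq_qr addrK.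
suff q0: q - q' = 0.
  split; first by apply/eqP; rewrite -subr_eq0 q0.
  by apply/esym/eqP; rewrite -subr_eq0 -Dqf q0 mul0r.
apply/eqP; apply: contraTT lt_r => nz_q; rewrite -leqNgt.
set d := q - q' in Dqf nz_q.
have sd_gt0: (0 < size (d : {poly S}))%N by rewrite size_poly_gt0.
pose k := ((size (d : {poly S})).-1 + (size (f : {poly S})).-1)%N.
have: (d * f : {poly S})`_k = lead_coef (d : {poly S}).
  have lt_dk: ((size (d : {poly S})).-1 < k.+1)%N by rewrite ltnS leq_addr.
  rewrite coef_skewM (bigD1 (Ordinal lt_dk)) //= /k addKn.
  rewrite -[f`_ _]/(lead_coef f) (monicP f_mon) rmorph1 mulr1.
  rewrite big1 ?addr0 // => i; rewrite -val_eqE /= neq_ltn => /orP[] lt_i.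
    rewrite [f`__]nth_default ?rmorph0 ?mulr0 //.
    rewrite leq_subRL ?(leq_trans (ltnW lt_i)) ?leq_addr //.
    by rewrite -[X in (_ + X)%N](prednK sf_gt0) addnS -addSn leq_add2r.
  by rewrite [_`_i]nth_default ?mul0r // -[X in (X <= _)%N](prednK sd_gt0).
rewrite Dqf (coefB (r' : {poly S}) (r : {poly S})) => Dk.
have nz_k: lead_coef (d : {poly S}) != 0 by rewrite lead_coef_eq0.
rewrite leqNgt; apply: contra nz_k => lt_rf; rewrite -Dk.
have le_fk: ((size (f : {poly S})).-1 <= k)%N by rewrite leq_addl.
by rewrite !nth_default ?subrr // (leq_trans _ le_fk) // -ltnS prednK.
Qed.

End Endomorphism.

Arguments skewC {S} sigma c.
Arguments skewX {S} sigma.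

Section PetitRing.

Variables (S : comUnitRingType) (sigma : {rmorphism S -> S}).
Variable f : skewpoly sigma.

(* Skew polynomials of degree < deg f; {poly_k S} bounds the size by k. *)
Definition petit : Type := {poly_(size (f : {poly S})).-1 S}.

HB.instance Definition _ :=
  GRing.Zmodule.copy petit {poly_(size (f : {poly S})).-1 S}.

Definition petit_poly (p : petit) : skewpoly sigma := polyn p.

(* The class of a skew polynomial modulo f. *)
Definition to_petit (g : skewpoly sigma) : petit :=
  npolyp _ (skew_rmod f g : {poly S}).

Definition petit_mul (g h : petit) : petit :=
  to_petit (petit_poly g * petit_poly h).

Definition petitC (c : S) : petit := to_petit (skewC sigma c).
Definition petit1 : petit := petitC 1.
Definition petitX : petit := to_petit (skewX sigma).

Definition hamming_weight (p : petit) : nat :=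
  count (fun c => c != 0) (petit_poly p : {poly S}).

Hypothesis f_monic : (f : {poly S}) \is monic.

Lemma to_petit_rmod g : petit_poly (to_petit g) = skew_rmod f g.
Proof.
have [lt_rf _] := skew_rmodP g f_monic.
by rewrite /petit_poly npolypK // -ltnS (ltn_predK lt_rf).
Qed.

Lemma to_petit_small (g : skewpoly sigma) :
  (size (g : {poly S}) < size (f : {poly S}))%N -> petit_poly (to_petit g) = g.
Proof.
by move=> lt_gf; rewrite to_petit_rmod /skew_rmod; case: size => [|k] /=;
   rewrite lt_gf.
Qed.

Lemma petit_poly_inj : injective petit_poly.
Proof. exact: val_inj. Qed.

Lemma petit_polyK p : to_petit (petit_poly p) = p.
Proof.
apply: petit_poly_inj; apply: to_petit_small.
have nz_f: (0 < size (f : {poly S}))%N by rewrite size_poly_gt0 monic_neq0.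
by rewrite -(prednK nz_f) ltnS size_npoly.
Qed.

Lemma to_petitD : {morph to_petit : g h / g + h}.
Proof.
move=> g h; apply: petit_poly_inj.
rewrite -[RHS]/(petit_poly (to_petit g) + petit_poly (to_petit h)).
rewrite !to_petit_rmod.
have [lt_g [q Dg]] := skew_rmodP g f_monic.
have [lt_h [q' Dh]] := skew_rmodP h f_monic.
have [lt_gh [q'' Dgh]] := skew_rmodP (g + h) f_monic.
suff [] : q'' = q + q' /\ skew_rmod f (g + h) = skew_rmod f g + skew_rmod f h.
  by [].
apply: (@skew_rmod_uniq _ _ f) => //.
  by rewrite (leq_ltn_trans (size_polyD _ _)) // gtn_max lt_g.
by rewrite -Dgh {1}Dg {1}Dh mulrDl addrACA.
Qed.

Lemma petit_mulDl : left_distributive petit_mul +%R.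
Proof. by move=> p q r; rewrite -to_petitD -mulrDl. Qed.

Lemma petit_mulDr : right_distributive petit_mul +%R.
Proof. by move=> p q r; rewrite -to_petitD -mulrDr. Qed.

Lemma petitCE c : (1 < size (f : {poly S}))%N ->
  petit_poly (petitC c) = skewC sigma c.
Proof.
by move=> lt1f; apply/to_petit_small/(leq_ltn_trans _ lt1f)/size_polyC_leq1.
Qed.

Lemma petitXE : (2 < size (f : {poly S}))%N ->
  petit_poly petitX = skewX sigma.
Proof. by move=> lt2f; rewrite to_petit_small // /skewX size_polyX. Qed.

Lemma petit_mul1l : (1 < size (f : {poly S}))%N -> left_id petit1 petit_mul.
Proof. by move=> lt1f p; rewrite /petit_mul petitCE // mul1r petit_polyK. Qed.

Lemma petit_mul1r : (1 < size (f : {poly S}))%N -> right_id petit1 petit_mul.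
Proof. by move=> lt1f p; rewrite /petit_mul petitCE // mulr1 petit_polyK. Qed.

End PetitRing.

Record petit_hom (S : comUnitRingType) (sigma : {rmorphism S -> S})
    (f g : skewpoly sigma) (G : petit f -> petit g) : Prop := PetitHom {
  petit_homD : {morph G : x y / x + y};
  petit_hom1 : G (petit1 f) = petit1 g;
  petit_homM : {morph G : x y / petit_mul x y}
}.

(* G_{tau,alpha}, as a map to S[t;sigma]. *)
Definition monomial_map (S : comUnitRingType) (sigma : {rmorphism S -> S})
    (tau : S -> S) (alpha : S) (p : {poly S}) : skewpoly sigma :=
  \poly_(i < size p) (tau p`_i * \prod_(0 <= j < i) iter j sigma alpha).

(* Main.v *)
Require Import Defs.
From HB Require Import structures.
From mathcomp Require Import all_boot all_order all_algebra.
From mathcomp Require Import zify ring.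

(* [G t] has weight one, so [G t = alpha t^k], and weights make [alpha] regular;
   [t c = sigma(c) t] then yields [sigma^k = sigma].  If [k > 2], the exponent of
   [G (t^i)] must pass [n] for some [i] with [i + 2 < n].  Comparing
   [(t^i t) c = t^i (t c)] with its image gives [sigma^n = id], and
   [(t t^i) t = t (t^i t)] gives [sigma b = b].  Finally [a = t t^(n-1)] has image
   [alpha sigma(beta) b], equal to [beta sigma^(-1)(alpha) b] because
   [t t^(n-1) = t^(n-1) t], so [sigma a = a].  These three identities contradict
   the hypothesis; the cases [k = 0, 2] force [sigma = id], so [k = 1]. *)

Set Implicit Arguments.
Unset Strict Implicit.
Unset Printing Implicit Defensive.

Import GRing.Theory.
Local Open Scope ring_scope.

(** * Monomials of the skew polynomial ring *)

Section SkewMonomials.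

Variables (S : comUnitRingType) (sigma : {rmorphism S -> S}).
Implicit Types (c d : S) (i j : nat).

Definition skewmon c i : skewpoly sigma := skewC sigma c * skewX sigma ^+ i.

Lemma skewmonE c i : skewmon c i = (c *: 'X^i : {poly S}).
Proof. exact: skewCXn. Qed.

Lemma skewCM c d : skewC sigma c * skewC sigma d = skewC sigma (c * d).
Proof.
apply/polyP => k; rewrite -[skewC sigma c]mulr1 -[1](expr0 (skewX sigma)).
by rewrite coef_skewCXnM subn0 !coefC /=; case: (k == _); rewrite ?mulr0.
Qed.

Lemma skewXnC c i :
  skewX sigma ^+ i * skewC sigma c = skewC sigma (iter i sigma c) * skewX sigma ^+ i.
Proof.
elim: i => [|i IHi]; first by rewrite mul1r mulr1.
by rewrite exprS -mulrA IHi mulrA skewXC -mulrA.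
Qed.

Lemma skewmonM c d i j :
  skewmon c i * skewmon d j = skewmon (c * iter i sigma d) (i + j).
Proof.
rewrite /skewmon -mulrA [skewX sigma ^+ i * _]mulrA skewXnC.
by rewrite -mulrA -exprD mulrA skewCM.
Qed.

Lemma size_skewmon c i : (size (skewmon c i : {poly S}) <= i.+1)%N.
Proof. by rewrite skewmonE (leq_trans (size_scale_leq _ _)) // size_polyXn. Qed.

End SkewMonomials.

(** * Monomials of the Petit ring of [t^n - b] *)

Section PetitMonomials.

Variables (S : comUnitRingType) (sigma : {rmorphism S -> S}) (n : nat) (b : S).
Implicit Types (c d : S) (i j : nat) (p : petit (skewXn_sub sigma n b)).

Definition pmon c i : petit (skewXn_sub sigma n b) :=
  to_petit (skewXn_sub sigma n b) (skewmon sigma c i).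

Lemma petitC_pmon c : petitC _ c = pmon c 0.
Proof. by rewrite /pmon /skewmon mulr1. Qed.

Lemma petitX_pmon : petitX _ = pmon 1 1.
Proof. by rewrite /pmon /skewmon mul1r. Qed.

Hypothesis n_gt0 : (0 < n)%N.
Let f_monic := skewXn_sub_monic sigma b n_gt0.

Lemma petit_poly_pmon c i : (i < n)%N -> petit_poly (pmon c i) = (c *: 'X^i : {poly S}).
Proof.
move=> lt_in; rewrite -(skewmonE sigma); apply: to_petit_small => //.
by rewrite size_skewXn_sub // ltnS (leq_trans (size_skewmon _ _ _)).
Qed.

Lemma pmonM c d i j : (i < n)%N -> (j < n)%N ->
  petit_mul (pmon c i) (pmon d j) = pmon (c * iter i sigma d) (i + j).
Proof.
move=> lt_in lt_jn; rewrite /petit_mul !petit_poly_pmon //.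
by rewrite -!(skewmonE sigma) skewmonM.
Qed.

(* [pmon c i] is the class of [c t^i] for every [i], also for [i >= n]. *)
Lemma pmon_wrap c i : pmon c (n + i) = pmon (c * iter i sigma b) i.
Proof.
set f := skewXn_sub sigma n b.
have sfE : size (f : {poly S}) = n.+1 by apply: size_skewXn_sub.
have kill (q : skewpoly sigma) : to_petit f (q * f) = 0.
  apply: petit_poly_inj; rewrite to_petit_rmod //.
  have [lt_r [q' Dq]] := skew_rmodP (q * f) f_monic.
  have := @skew_rmod_uniq _ _ f q' q (skew_rmod f (q * f)) 0 f_monic lt_r.
  rewrite addr0 -Dq => /(_ _ erefl) [] //.
  by rewrite sfE size_poly0.
(* Split [t^n = (t^n - b) + b] to the right of [c t^i]; moving [b] to the left across [t^i] turns it
   into [sigma^i(b)]. *)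
suff Dt : skewmon sigma c (n + i)
        = skewmon sigma c i * f + skewmon sigma (c * iter i sigma b) i.
  by rewrite /pmon Dt to_petitD // kill add0r.
rewrite -[X in _ + X](_ : skewmon sigma c i * skewC sigma b = _).
  by rewrite -mulrDr /f /skewXn_sub subrK /skewmon -mulrA -exprD addnC.
by rewrite /skewmon -mulrA skewXnC mulrA skewCM.
Qed.

Lemma pmon_inj c d i j : (i < n)%N -> (j < n)%N -> c != 0 ->
  pmon c i = pmon d j -> i = j /\ c = d.
Proof.
move=> lt_in lt_jn nz_c /(congr1 (@petit_poly _ _ _)).
rewrite !petit_poly_pmon // => /polyP/(_ i).
rewrite !coefZ !coefXn eqxx mulr1; case: eqP => [-> | _]; first by rewrite mulr1.
by move=> c0; rewrite c0 mulr0 eqxx in nz_c.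
Qed.

(** The range of [i] covers products of two reduced monomials: at most one wrap occurs, and it
    multiplies by a unit [sigma^(i-n)(b)], which cancels. *)
Lemma pmon_coef_inj c d i : b \is a GRing.unit -> (i < n + n)%N ->
  pmon c i = pmon d i -> c = d.
Proof.
move=> b_unit lt_i2n.
have small x y j : (j < n)%N -> pmon x j = pmon y j -> x = y.
  move=> lt_jn /(congr1 (@petit_poly _ _ _)); rewrite !petit_poly_pmon //.
  by move/polyP/(_ j); rewrite !coefZ !coefXn eqxx !mulr1.
have [/small | le_ni] := ltnP i n; first exact.
rewrite -(subnKC le_ni) !pmon_wrap => /small cd.
by apply: (mulIr (rmorph_unit (iter (i - n) sigma) b_unit)); apply: cd;
   rewrite ltn_subLR.
Qed.

Lemma size_petit_poly p : (size (petit_poly p : {poly S}) <= n)%N.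
Proof. by apply: leq_trans (size_npoly p) _; rewrite size_skewXn_sub. Qed.

Lemma petit_poly_sum (c : nat -> S) :
  petit_poly (\sum_(i < n) pmon (c i) i) = (\poly_(i < n) c i : {poly S}).
Proof.
rewrite poly_def (big_morph (fun x : petit _ => petit_poly x : {poly S})
                            (id1 := 0) (op1 := +%R)) //.
by apply: eq_bigr => i _; rewrite petit_poly_pmon.
Qed.

Lemma petit_pmon_sum p : p = \sum_(i < n) pmon (petit_poly p : {poly S})`_i i.
Proof.
apply: petit_poly_inj; rewrite petit_poly_sum.
apply/polyP => k; rewrite coef_poly; case: ltnP => // le_nk.
by rewrite nth_default // (leq_trans (size_petit_poly p)).
Qed.

Lemma weight_pmon c i : (i < n)%N -> hamming_weight (pmon c i) = (c != 0).
Proof.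
move=> lt_in; rewrite /hamming_weight petit_poly_pmon //.
have [-> | nz_c] := eqVneq c 0; first by rewrite scale0r polyseq0.
rewrite -mul_polyC.
by rewrite polyseqMXn ?polyC_eq0 // polyseqC nz_c -cat_nseq count_cat
           count_nseq /= eqxx nz_c.
Qed.

(** The leading coefficient is nonzero, so it is the one counted and all lower ones vanish. *)
Lemma weight1P p : hamming_weight p = 1%N ->
   exists c i, (i < n)%N /\ p = pmon c i.
Proof.
rewrite /hamming_weight; move: (size_petit_poly p).
have : last 1 (petit_poly p : {poly S}) != 0.
  by case: (petit_poly p : {poly S}) => s.
case E : (polyseq (petit_poly p)) / lastP => [|s x] //.
rewrite last_rcons size_rcons -cats1 count_cat /= => nz_x lt_sn.
rewrite nz_x addn1 => -[] /eqP; rewrite eqn0Ngt -has_count => /hasPn s0.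
exists x, (size s); split=> //; apply: petit_poly_inj; rewrite petit_poly_pmon //.
apply/polyP => k; rewrite coefZ coefXn E nth_rcons.
case: ltngtP => [lt_ks | _ | _]; rewrite ?mulr0 ?mulr1 //.
by apply/eqP; have /negPn := s0 _ (mem_nth 0 lt_ks).
Qed.

End PetitMonomials.

(** * Images of monomials under a weight preserving homomorphism *)

Section PetitHom.

Variables (S : comUnitRingType) (sigma : {rmorphism S -> S}).
Hypothesis sigma_inj : injective sigma.
Variables (n : nat) (a b : S).
Hypotheses (n_ge2 : (2 <= n)%N) (a_unit : a \is a GRing.unit)
           (b_unit : b \is a GRing.unit).
Variable G : petit (skewXn_sub sigma n a) -> petit (skewXn_sub sigma n b).
Hypotheses (G_hom : petit_hom G)
           (G_weight : forall p, hamming_weight (G p) = hamming_weight p).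
Variable tau : {rmorphism S -> S}.
Hypotheses (tau_bij : bijective tau)
           (tau_sigma : forall c, tau (sigma c) = sigma (tau c))
           (G_tau : forall c, G (petitC _ c) = petitC _ (tau c)).

Let n_gt0 : (0 < n)%N. Proof. exact: ltnW. Qed.
Local Notation A := (pmon sigma n a).
Local Notation B := (pmon sigma n b).
Implicit Types (c d e alpha beta : S) (i j k r s : nat).

Lemma iter_inj i : injective (iter i sigma).
Proof. by elim: i => [|i IHi] x y //= /sigma_inj/IHi. Qed.

Lemma tau_iter i c : tau (iter i sigma c) = iter i sigma (tau c).
Proof. by elim: i => //= i IHi; rewrite tau_sigma IHi. Qed.

Lemma hom_pmonZ c i d j : (i < n)%N -> (j < n)%N -> G (A 1 i) = B d j ->
  G (A c i) = B (tau c * d) j.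
Proof.
move=> lt_in lt_jn Gi; have := pmonM sigma a n_gt0 c 1 n_gt0 lt_in.
rewrite /= mulr1 add0n => <-; rewrite (petit_homM G_hom) Gi.
by rewrite -petitC_pmon G_tau petitC_pmon pmonM.
Qed.

Lemma hom_pmon_exists i : (i < n)%N -> exists d j, (j < n)%N /\ G (A 1 i) = B d j.
Proof.
by move=> lt_in; apply: weight1P => //; rewrite G_weight weight_pmon // oner_eq0.
Qed.

(** The image of [tau^(-1)(c) t^i] is [c d t^j]; if this is zero, preservation of weight forces
    [tau^(-1)(c) = 0]. *)
Lemma hom_pmon_reg i d j : (i < n)%N -> (j < n)%N -> G (A 1 i) = B d j ->
  forall c, d * c = 0 -> c = 0.
Proof.
move=> lt_in lt_jn Gi c dc0; have [tau' _ tauK] := tau_bij.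
have := G_weight (A (tau' c) i); rewrite (hom_pmonZ _ lt_in lt_jn Gi).
rewrite !weight_pmon // tauK mulrC dc0 eqxx /=.
by case: eqP => // c0 _; rewrite -(tauK c) c0 rmorph0.
Qed.

(** Applying [G] to [t^i c' = sigma^i(c') t^i] with [c' = tau^(-1)(c)] gives
    [d sigma^j(c) = sigma^i(c) d], and [d] is regular. *)
Lemma hom_pmon_iter i d j : (i < n)%N -> (j < n)%N -> G (A 1 i) = B d j ->
  iter j sigma =1 iter i sigma.
Proof.
move=> lt_in lt_jn Gi c; have [tau' _ tauK] := tau_bij.
have /(congr1 G) := pmonM sigma a n_gt0 1 (tau' c) lt_in n_gt0.
rewrite (petit_homM G_hom) Gi mul1r addn0 (hom_pmonZ _ lt_in lt_jn Gi).
rewrite -petitC_pmon G_tau petitC_pmon pmonM // addn0 tau_iter tauK.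
rewrite mulrC => /pmon_coef_inj-/(_ n_gt0 b_unit (ltn_addr n lt_jn)) Dd.
apply/eqP; rewrite -subr_eq0; apply/eqP.
by apply: (hom_pmon_reg lt_in lt_jn Gi); rewrite mulrC mulrBl Dd subrr.
Qed.

(** Only the source product must stay below degree [n]; [j + j'] may reach or pass [n]. *)
Lemma hom_pmonM i d j i' d' j' : (i + i' < n)%N -> (j < n)%N -> (j' < n)%N ->
  G (A 1 i) = B d j -> G (A 1 i') = B d' j' ->
  G (A 1 (i + i')) = B (d * iter j sigma d') (j + j').
Proof.
move=> lt_ii'n lt_jn lt_j'n Gi Gi'; rewrite -pmonM // -Gi -Gi' -(petit_homM G_hom).
by rewrite pmonM ?rmorph1 ?mulr1 //; apply: leq_ltn_trans lt_ii'n;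
   rewrite ?leq_addl ?leq_addr.
Qed.

Lemma hom_pmon0 : G (A 1 0) = B 1 0.
Proof. by rewrite -!petitC_pmon G_tau rmorph1. Qed.

(** * Consequences of an image exponent reaching [n] *)

Section Wrap.

Variables (alpha : S) (k : nat).
Hypotheses (lt_kn : (k < n)%N) (G1 : G (A 1 1) = B alpha k).

Let iter_k : iter k sigma =1 sigma. Proof. exact: (hom_pmon_iter _ _ G1). Qed.

(** Until the first wrap, [G (t^l)] has exponent [l k]. The margin [i + 2 < n] lets [t^i] be
    multiplied by [t] twice without wrapping in the source. *)
Lemma hom_pmon_wrap : (2 < k)%N ->
  exists i d j, [/\ (i.+2 < n)%N, (j < n)%N, (n <= j + k)%N & G (A 1 i) = B d j].
Proof.
move=> k_gt2.
suff main l : (l.+2 <= n)%N ->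
    (exists i d j, [/\ (i.+2 < n)%N, (j < n)%N, (n <= j + k)%N & G (A 1 i) = B d j])
    \/ (exists2 d, G (A 1 l) = B d (l * k) & (l * k < n)%N).
  (* From [3 <= k < n] follows [n >= 4], hence [(n - 2) k >= n]: the second alternative is
     impossible. *)
  have [] // := main n.-2; first by lia.
  by case=> d _; nia.
elim: l => [_ | l IHl lt_ln]; first by right; exists 1; rewrite ?hom_pmon0.
have [|| [d Gl lt_lkn]] := IHl; [exact: ltnW | by left |].
have [le_nlk | lt_lkkn] := leqP n (l * k + k); first by left; exists l, d, (l * k)%N.
right; exists (d * iter (l * k) sigma alpha); rewrite mulSn addnC //.
by rewrite -addn1; apply: hom_pmonM => //; lia.
Qed.

Section Step.

Variables (i : nat) (d : S) (j : nat).
Hypotheses (lt_i2n : (i.+2 < n)%N) (lt_jn : (j < n)%N) (le_njk : (n <= j + k)%N)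
           (Gi : G (A 1 i) = B d j).

Let lt_i1n : (i.+1 < n)%N. Proof. exact: ltnW. Qed.
Let lt_in : (i < n)%N. Proof. exact: ltnW. Qed.
Let r := (j + k - n)%N.
Let lt_rn : (r < n)%N. Proof. by rewrite /r; lia. Qed.
Let e := d * iter j sigma alpha * iter r sigma b.

(** As [j + k < 2n], a single wrap reduces [t^j t^k]; it contributes the last factor of [e]. *)
Let GiS : G (A 1 i.+1) = B e r.
Proof.
rewrite -[in LHS]addn1 (hom_pmonM _ lt_jn lt_kn Gi G1) ?addn1 //.
by rewrite -pmon_wrap // subnKC.
Qed.

(** Both [sigma^(j+k)] and [sigma^r] equal [sigma^(i+1)], and [j + k = r + n]. *)
Lemma sigma_iter_n : iter n sigma =1 id.
Proof.
move=> c; apply: (@iter_inj r); rewrite -iterD addnC subnKC // iterD.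
rewrite (hom_pmon_iter lt_in lt_jn Gi) iter_k -iterSr.
by rewrite (hom_pmon_iter lt_i1n lt_rn GiS).
Qed.

Lemma sigma_b : sigma b = b.
Proof.
(* This is the image of [t t^i' = t^i' t]. *)
have comm i' d' j' : (i'.+1 < n)%N -> (j' < n)%N -> G (A 1 i') = B d' j' ->
    alpha * sigma d' = d' * iter i' sigma alpha.
  move=> lt_i'1n lt_j'n Gi'.
  rewrite -iter_k -(hom_pmon_iter (ltnW lt_i'1n) lt_j'n Gi').
  apply: (@pmon_coef_inj _ sigma n b n_gt0 _ _ (j' + k) b_unit).
    by rewrite -addSn leq_add // ltnW.
  rewrite -[RHS](hom_pmonM _ _ _ Gi' G1) ?addn1 // [X in B _ X]addnC.
  by rewrite -(hom_pmonM _ _ _ G1 Gi').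
(* Since [sigma^n = id], applying [sigma^(n-i-1)] reduces this to the regularity of [alpha]. *)
have alpha_reg c : iter i.+1 sigma alpha * c = 0 -> c = 0.
  have alphaE : iter (n - i.+1) sigma (iter i.+1 sigma alpha) = alpha.
    by rewrite -iterD subnK ?sigma_iter_n // ltnW.
  move=> /(congr1 (iter (n - i.+1) sigma)).
  rewrite rmorphM rmorph0 [X in X * _]alphaE.
  move/(hom_pmon_reg n_ge2 lt_kn G1) => c0.
  by apply: (@iter_inj (n - i.+1)); rewrite c0 rmorph0.
have e_reg := hom_pmon_reg lt_i1n lt_rn GiS.
(* Put [x = sigma^(i+1)(alpha)], [u = d sigma^i(alpha)], [y = sigma^r(b)], so [e = u y]. Commutation
   at [i + 1], simplified by commutation at [i], becomes [u x sigma(y) = e x]. *)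
have := comm _ _ _ lt_i2n lt_rn GiS.
have eE : e = d * iter i sigma alpha * iter r sigma b.
  by rewrite -(hom_pmon_iter lt_in lt_jn Gi).
rewrite [in sigma e]eE !rmorphM !mulrA (comm _ _ _ lt_i1n lt_jn Gi).
rewrite -/(iter i.+1 sigma alpha); move: (iter i.+1 sigma alpha) alpha_reg => x x_reg.
move: (d * _) eE => u eE exb; apply: (@iter_inj r); rewrite -iterSr /=.
move: (iter r sigma b) eE exb => y eE exb.
apply/eqP; rewrite -subr_eq0; apply/eqP/x_reg/e_reg.
(* Regularity is at hand for [e] rather than [u], so the relation is multiplied by [y]. *)
have -> : e * (x * (sigma y - y)) = y * (u * x * sigma y - e * x) by rewrite eE; ring.
by rewrite exb subrr mulr0.
Qed.

Lemma sigma_a : sigma a = a.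
Proof.
have lt_n1n : (n.-1 < n)%N by rewrite prednK.
have [beta [s [lt_sn Gn1]]] := hom_pmon_exists lt_n1n.
have s_iter := hom_pmon_iter lt_n1n lt_sn Gn1.
have GaE : G (A 1 n) = B (tau a) 0.
  by rewrite -[n in A 1 n]addn0 pmon_wrap // mul1r -petitC_pmon G_tau petitC_pmon.
have lr : B (tau a) 0 = B (alpha * sigma beta) (k + s).
  rewrite -iter_k -pmonM // -G1 -Gn1 -(petit_homM G_hom) pmonM //.
  by rewrite rmorph1 mulr1 add1n prednK.
have rl : B (tau a) 0 = B (beta * iter n.-1 sigma alpha) (k + s).
  rewrite -s_iter addnC -pmonM // -G1 -Gn1 -(petit_homM G_hom) pmonM //.
  by rewrite rmorph1 mulr1 addn1 prednK.
have nz_ta : tau a != 0.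
  by apply: contraTneq (rmorph_unit tau a_unit) => ->; rewrite unitr0.
(* Without a wrap [k + s = 0], but [j < n <= j + k] excludes [k = 0]. With a wrap, the exponent left
   over is [0], so the extra factor is [b] itself. *)
have [lt_ksn | le_nks] := ltnP (k + s) n.
  have [Dks _] := pmon_inj n_gt0 n_gt0 lt_ksn nz_ta lr.
  by move: lt_jn le_njk; rewrite (_ : k = 0); lia.
move: lr rl; rewrite -(subnKC le_nks) !pmon_wrap // => lr rl.
have lt_ksnn : (k + s - n < n)%N by lia.
have [Dks taE] := pmon_inj n_gt0 n_gt0 lt_ksnn nz_ta lr.
have [_ taE'] := pmon_inj n_gt0 n_gt0 lt_ksnn nz_ta rl.
rewrite -Dks /= in taE taE'.
(* Applying [sigma] to [beta sigma^(n-1)(alpha) b] gives [sigma(beta) alpha b], the other expression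
   for [tau a]. *)
apply: (bij_inj tau_bij); rewrite tau_sigma taE' !rmorphM sigma_b /=.
by rewrite -iterS prednK // sigma_iter_n -taE' taE [sigma beta * _]mulrC.
Qed.

End Step.
End Wrap.

Lemma hom_pmon_deg alpha k : (k < n)%N -> G (A 1 1) = B alpha k -> k != 1%N ->
  [/\ iter n sigma =1 id, sigma a = a & sigma b = b].
Proof.
move=> lt_kn G1 k_neq1; have iter_k := hom_pmon_iter n_ge2 lt_kn G1.
have trivial_case : sigma =1 id -> [/\ iter n sigma =1 id, sigma a = a & sigma b = b].
  by move=> sigma_id; split=> // c; elim: n => //= l ->.
have [k_gt2 | k_le2] := ltnP 2 k.
  have [i [d [j [lt_i2n lt_jn le_njk Gi]]]] := hom_pmon_wrap lt_kn G1 k_gt2.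
  split; [exact: (sigma_iter_n lt_kn G1 lt_i2n lt_jn le_njk Gi) |
    exact: (sigma_a lt_kn G1 lt_i2n lt_jn le_njk Gi) |
    exact: (sigma_b lt_kn G1 lt_i2n lt_jn le_njk Gi)].
(* For [k = 0], [sigma^k = sigma] reads [id = sigma]; for [k = 2], one [sigma] cancels by
   injectivity. *)
apply: trivial_case => c; case: k k_neq1 k_le2 iter_k {G1 lt_kn} => [|[|[|]]] // _ _.
  by move/(_ c) => /= <-.
by move/(_ c) => /= /sigma_inj.
Qed.

Lemma hom_pmon_deg1 alpha i : G (A 1 1) = B alpha 1 -> (i < n)%N ->
  G (A 1 i) = B (\prod_(0 <= j < i) iter j sigma alpha) i.
Proof.
move=> G1; elim: i => [_ | i IHi lt_i1n]; first by rewrite big_nil hom_pmon0.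
rewrite big_nat_recr //= -[in LHS]addn1 -[in RHS](addn1 i).
by apply: hom_pmonM; rewrite ?addn1 // ?IHi // ltnW.
Qed.

Lemma hom_monomial alpha : G (A 1 1) = B alpha 1 ->
  forall p, petit_poly (G p) = monomial_map sigma tau alpha (petit_poly p).
Proof.
move=> G1 p; have GD := petit_homD G_hom.
have G0 : G 0 = 0 by apply: (addIr (G 0)); rewrite -GD !add0r.
rewrite {1}(petit_pmon_sum n_gt0 p) (big_morph G GD G0).
pose c i := tau (petit_poly p : {poly S})`_i * \prod_(0 <= j < i) iter j sigma alpha.
rewrite (eq_bigr (fun i : 'I_n => B (c i) i)) => [|i _]; last first.
  exact: hom_pmonZ (hom_pmon_deg1 G1 (ltn_ord i)).
rewrite petit_poly_sum //; apply/polyP => i; rewrite !coef_poly.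
(* The two sides truncate at [n] and at the size of [p]; between these bounds the coefficients are
   [tau 0 = 0]. *)
have [lt_ip | le_pi] := ltnP i (size (petit_poly p : {poly S})).
  by rewrite (leq_trans lt_ip) // size_petit_poly.
by rewrite /c [_`_i]nth_default // rmorph0 mul0r if_same.
Qed.

End PetitHom.

(** * The order of [sigma] and the conclusion *)

Lemma order_dvd (S : comUnitRingType) (sigma : {rmorphism S -> S}) m n :
  has_order sigma m -> iter n sigma =1 id -> (m %| n)%N.
Proof.
case=> m_gt0 sigma_m m_min sigma_n; rewrite /dvdn eqn0Ngt.
(* A nonzero remainder would be a positive period smaller than [m]. *)
apply/negP => r_gt0; apply: (m_min (n %% m)%N); first by rewrite r_gt0 ltn_mod.
move=> c; rewrite -[RHS]sigma_n [in RHS](divn_eq n m) addnC iterD; congr iter.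
by elim: (n %/ m)%N => // q IHq; rewrite mulSn iterD -IHq sigma_m.
Qed.

Theorem corollary4p5 (S : comUnitRingType) (sigma : {rmorphism S -> S})
    (sigma_bij : bijective sigma) (m : nat) (sigma_order : has_order sigma m)
    (n : nat) (n_ge2 : (2 <= n)%N)
    (a b : S) (a_unit : a \is a GRing.unit) (b_unit : b \is a GRing.unit)
    (mn_ab : [\/ ~~ (m %| n)%N, a \notin fixed_ring sigma
               | b \notin fixed_ring sigma])
    (G : petit (skewXn_sub sigma n a) -> petit (skewXn_sub sigma n b))
    (G_hom : petit_hom G)
    (G_weight : forall p, hamming_weight (G p) = hamming_weight p)
    (tau : {rmorphism S -> S}) (tau_bij : bijective tau)
    (tau_sigma : forall c, tau (sigma c) = sigma (tau c))
    (G_tau : forall c, G (petitC _ c) = petitC _ (tau c)) :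
  exists alpha : S,
    [/\ forall c, alpha * c = 0 -> c = 0,
        G (petitX _) = petit_mul (petitC _ alpha) (petitX _)
      & forall p, petit_poly (G p) = monomial_map sigma tau alpha (petit_poly p)].
Proof.
have sigma_inj := bij_inj sigma_bij; have n_gt0 := ltnW n_ge2.
have [alpha [k [lt_kn G1]]] := hom_pmon_exists n_ge2 G_weight n_ge2.
have [k1 | k_neq1] := eqVneq k 1%N; last first.
  have [sigma_n sigma_a sigma_b] := hom_pmon_deg sigma_inj n_ge2 a_unit b_unit
    G_hom G_weight tau_bij tau_sigma G_tau lt_kn G1 k_neq1.
  case: mn_ab; first by rewrite (order_dvd sigma_order sigma_n).
    by rewrite inE sigma_a eqxx.
  by rewrite inE sigma_b eqxx.
rewrite k1 in lt_kn G1; exists alpha; split.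
- exact: (hom_pmon_reg n_ge2 G_hom G_weight tau_bij G_tau n_ge2 lt_kn G1).
- by rewrite !petitX_pmon G1 petitC_pmon pmonM //= mulr1.
- exact: (hom_monomial n_ge2 G_hom G_tau G1).
Qed.
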